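(* $$\sup_{\square\subset\mathbb{H}^2,\ D(\square)>0}\frac{\delta(\square)}{D(\square)}=\frac{\sqrt{2}-1}{\sqrt{2}},$$ where the supremum is over all quadruples $\square$ of points in the hyperbolic plane $\mathbb{H}^2$ with positive diameter.
   Context: $\mathbb{H}^2$ is the hyperbolic plane: the complete, simply connected Riemannian surface of constant curvature $-1$, viewed as a metric space with its geodesic distance $d$. A quadruple $\square=\{a,b,c,d\}$ in a metric space is a choice of four (not necessarily distinct) points. Its three pairwise distance sums are $d(a,b)+d(c,d)$, $d(a,c)+d(b,d)$, $d(a,d)+d(b,c)$; label them so that $S\le M\le L$, and set $\delta(\square)=\frac{L-M}{2}$. The diameter $D(\square)$ is the largest distance between two points of $\square$. *)

(* Defs.v *)
From Stdlib Require Import Reals.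
From Coquelicot Require Import Coquelicot.
Open Scope R_scope.

(** The hyperbolic plane is represented by the upper half-plane
    [{(x, y) | 0 < y}] with the Riemannian metric [(dx^2 + dy^2) / y^2], which
    is complete, simply connected and of constant curvature [-1]. *)
Record H2 : Type := mkH2 { hx : R; hy : R; hy_pos : 0 < hy }.

Definition is_C1 (f : R -> R) : Prop :=
  forall t, ex_derive f t /\ continuous (Derive f) t.

(** The coordinate functions are [C^1] on all of [R], but only their
    restriction to [[0, 1]] matters: every [C^1] function on [[0, 1]] extends
    to a [C^1] function on [R]. *)
Definition C1_path (p q : H2) (x y : R -> R) : Prop :=
  is_C1 x /\ is_C1 y /\
  (forall t, 0 <= t <= 1 -> 0 < y t) /\
  x 0 = hx p /\ y 0 = hy p /\ x 1 = hx q /\ y 1 = hy q.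

Definition path_length (x y : R -> R) : R :=
  RInt (fun t => sqrt ((Derive x t) ^ 2 + (Derive y t) ^ 2) / y t) 0 1.

(** Geodesic distance.  The set of lengths is nonempty (straight segments) and
    bounded below by 0, so its greatest lower bound in [Rbar] is finite.
    Allowing piecewise [C^1] paths would not change it, since a corner can be
    made [C^1] by a reparametrization with zero velocity there. *)
Definition hdist (p q : H2) : R :=
  real (Glb_Rbar (fun l : R =>
    exists x y : R -> R, C1_path p q x y /\ l = path_length x y)).

Definition max3 (r s t : R) : R := Rmax r (Rmax s t).
Definition min3 (r s t : R) : R := Rmin r (Rmin s t).
(** The middle one of three reals, counted with multiplicity. *)
Definition mid3 (r s t : R) : R := r + s + t - max3 r s t - min3 r s t.

Definition delta {X : Type} (dist : X -> X -> R) (a b c d : X) : R :=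
  let s1 := dist a b + dist c d in
  let s2 := dist a c + dist b d in
  let s3 := dist a d + dist b c in
  (max3 s1 s2 s3 - mid3 s1 s2 s3) / 2.

Definition diam {X : Type} (dist : X -> X -> R) (a b c d : X) : R :=
  Rmax (max3 (dist a b) (dist a c) (dist a d))
       (max3 (dist b c) (dist b d) (dist c d)).

(* Main.v *)
Require Import Defs.
From Stdlib Require Import Reals Lra Classical.
From Coquelicot Require Import Coquelicot.
Open Scope R_scope.

(** The upper bound holds in every CAT(0) space.  Four points [a, b, c, d] of
    such a space satisfy, like points of the Euclidean plane, the parallelogram
    type inequality [quadrilateral_inequality] and Ptolemy's inequality
    [ptolemy_inequality].  Adding the first to twice the second gives
    [(ac + bd)^2 <= (ab + cd)^2 + (ad + bc)^2] for every labelling of the four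
    points, hence [L^2 <= M^2 + S^2 <= 2 M^2].
    Since [L <= 2 D], this yields
    [(L - M) / 2 <= (1 - 1 / sqrt 2) L / 2 <= (1 - 1 / sqrt 2) D].

    That the hyperbolic plane is CAT(0) is derived from the formula
    [cosh (hdist p q) = ((x - x')^2 + y^2 + y'^2) / (2 y y')] ([cosh_hdist]).
    To obtain the formula, every pair of points is put on an explicit geodesic
    line (a vertical ray or a half-circle); a path along the line has the
    expected length, and no path is shorter because Busemann functions are
    1-Lipschitz ([busemann_le_length]).  Along a line of unit speed,
    [cosh (hdist b (g s))] is a combination of [cosh s] and [sinh s], so the
    median [m] of a triangle with sides [beta, gamma, 2 h] satisfies
    [cosh beta + cosh gamma = 2 cosh h cosh m]; convexity of
    [t |-> cosh (sqrt t)] turns this into the comparison of [m] with the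
    Euclidean median ([cosh_median]), and midpoint convexity extends it from
    the midpoint to all points of the side ([hdist_comparison]).

    The constant is approached by the squares whose vertices lie at distance
    [rho] from a centre in four orthogonal directions: their diagonals are
    [2 rho], their sides [s] satisfy [cosh s = cosh rho ^ 2], and
    [s / rho] tends to [sqrt 2] as [rho] tends to 0, as in the Euclidean
    plane. *)

(** * Hyperbolic functions *)

Lemma nondecreasing_of_derive (f df : R -> R) (a b : R) :
  a <= b ->
  (forall x, a <= x <= b -> is_derive f x (df x)) ->
  (forall x, a <= x <= b -> 0 <= df x) ->
  f a <= f b.
Proof.
  intros Hab Hd Hp.
  destruct (MVT_gen f a b df) as [c [Hc E]];
    rewrite ?Rmin_left, ?Rmax_right in * by lra.
  - intros x Hx; apply Hd; lra.
  - intros x Hx. apply continuity_pt_filterlim, (ex_derive_continuous f).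
    exists (df x); apply Hd; lra.
  - pose proof (Hp c Hc). nra.
Qed.

Lemma cosh_pos (x : R) : 0 < cosh x.
Proof. unfold cosh. pose proof (exp_pos x); pose proof (exp_pos (- x)); lra. Qed.

Lemma cosh2_sinh2 (x : R) : cosh x ^ 2 = 1 + sinh x ^ 2.
Proof.
  unfold cosh, sinh. assert (E : exp x * exp (- x) = 1)
    by (rewrite <- exp_plus, Rplus_opp_r; apply exp_0).
  nra.
Qed.

Lemma cosh_opp (x : R) : cosh (- x) = cosh x.
Proof. unfold cosh. rewrite Ropp_involutive. lra. Qed.

Lemma cosh_Rabs (x : R) : cosh (Rabs x) = cosh x.
Proof. unfold Rabs; destruct (Rcase_abs x); auto using cosh_opp. Qed.

Lemma cosh_plus (x y : R) : cosh (x + y) = cosh x * cosh y + sinh x * sinh y.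
Proof. unfold cosh, sinh. rewrite Ropp_plus_distr, !exp_plus. field. Qed.

Lemma cosh_minus (x y : R) : cosh (x - y) = cosh x * cosh y - sinh x * sinh y.
Proof.
  unfold cosh, sinh, Rminus.
  rewrite Ropp_plus_distr, Ropp_involutive, !exp_plus. field.
Qed.

Lemma sinh_plus (x y : R) : sinh (x + y) = sinh x * cosh y + cosh x * sinh y.
Proof. unfold cosh, sinh. rewrite Ropp_plus_distr, !exp_plus. field. Qed.

Lemma is_derive_cosh (x : R) : is_derive cosh x (sinh x).
Proof. apply is_derive_Reals, derivable_pt_lim_cosh. Qed.

Lemma sinh_nonneg (x : R) : 0 <= x -> 0 <= sinh x.
Proof.
  intros [H | <-]; [| rewrite sinh_0; lra].
  apply sinh_lt in H. rewrite sinh_0 in H. lra.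
Qed.

Lemma cosh_le (x y : R) : 0 <= x -> x <= y -> cosh x <= cosh y.
Proof.
  intros Hx Hxy. apply (nondecreasing_of_derive cosh sinh); [lra | |].
  - intros z _; apply is_derive_cosh.
  - intros z Hz; apply sinh_nonneg; lra.
Qed.

Lemma cosh_lt (x y : R) : 0 <= x -> x < y -> cosh x < cosh y.
Proof.
  intros Hx Hxy.
  pose proof (sinh_lt x y Hxy). pose proof (sinh_nonneg x Hx).
  pose proof (cosh2_sinh2 x); pose proof (cosh2_sinh2 y).
  pose proof (cosh_pos x); pose proof (cosh_pos y). nra.
Qed.

Lemma cosh_le_inv (x y : R) : 0 <= y -> cosh x <= cosh y -> x <= y.
Proof.
  intros Hy H. destruct (Rle_lt_dec x y) as [|L]; [assumption|].
  apply cosh_lt in L; lra.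
Qed.

Lemma cosh_ge_1 (x : R) : 1 <= cosh x.
Proof.
  rewrite <- cosh_Rabs, <- cosh_0.
  apply cosh_le; [lra | apply Rabs_pos].
Qed.

(** Convexity of [sinh] on the half-line, where it vanishes at 0.  In the form
    of an inequality between values it says that [sinh x / x] increases, which
    is what makes [t |-> cosh (sqrt t)] convex. *)
Lemma sinh_sublinear (l y : R) :
  0 <= l <= 1 -> 0 <= y -> sinh (l * y) <= l * sinh y.
Proof.
  intros Hl Hy.
  enough (l * sinh 0 - sinh (l * 0) <= l * sinh y - sinh (l * y)) as H
    by (rewrite Rmult_0_r, sinh_0 in H; lra).
  apply (nondecreasing_of_derive (fun z => l * sinh z - sinh (l * z))
           (fun z => l * (cosh z - cosh (l * z)))); [assumption | |].
  - intros z _. auto_derive; [trivial | ring].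
  - intros z Hz.
    assert (cosh (l * z) <= cosh z) by (apply cosh_le; nra). nra.
Qed.

Lemma sinh_ge_id (y : R) : 0 <= y -> y <= sinh y.
Proof.
  intros Hy.
  enough (sinh 0 - 0 <= sinh y - y) by (rewrite sinh_0 in *; lra).
  apply (nondecreasing_of_derive (fun z => sinh z - z) (fun z => cosh z - 1));
    [assumption | |].
  - intros z _. auto_derive; [trivial | ring].
  - intros z _. pose proof (cosh_ge_1 z). lra.
Qed.

(** The derivative of [t |-> cosh (sqrt t)] at [t = x ^ 2] for [x >= 0],
    one-sided at 0. *)
Definition cosh_sqrt_slope (x : R) : R :=
  if Req_EM_T x 0 then 1 / 2 else sinh x / (2 * x).

Lemma sinh_slope (x : R) : sinh x = 2 * cosh_sqrt_slope x * x.
Proof.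
  unfold cosh_sqrt_slope. destruct (Req_EM_T x 0) as [-> | N].
  - rewrite sinh_0; ring.
  - field; assumption.
Qed.

Lemma cosh_sqrt_slope_le (x y : R) :
  0 <= x -> x <= y -> cosh_sqrt_slope x <= cosh_sqrt_slope y.
Proof.
  intros Hx Hxy.
  destruct (Req_EM_T y 0) as [-> | Ny].
  { replace x with 0 by lra. apply Rle_refl. }
  apply (Rmult_le_reg_r (2 * y)); [lra|].
  replace (cosh_sqrt_slope y * (2 * y)) with (sinh y)
    by (rewrite (sinh_slope y); ring).
  unfold cosh_sqrt_slope at 1. destruct (Req_EM_T x 0) as [_ | Nx].
  - pose proof (sinh_ge_id y). lra.
  - assert (H : sinh (x / y * y) <= x / y * sinh y).
    { apply sinh_sublinear; [| lra]. split.
      - apply Rdiv_le_0_compat; lra.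
      - apply (Rmult_le_reg_r y); [lra|]. field_simplify; lra. }
    replace (x / y * y) with x in H by (field; lra).
    apply (Rmult_le_reg_r (x / y)); [apply Rdiv_lt_0_compat; lra|].
    replace (sinh x / (2 * x) * (2 * y) * (x / y)) with (sinh x)
      by (field; lra).
    lra.
Qed.

Lemma cosh_sqrt_slope_pos (x : R) : 0 <= x -> 0 < cosh_sqrt_slope x.
Proof.
  intros Hx. apply Rlt_le_trans with (cosh_sqrt_slope 0).
  - unfold cosh_sqrt_slope. destruct (Req_EM_T 0 0); lra.
  - apply cosh_sqrt_slope_le; lra.
Qed.

(** The graph of [t |-> cosh (sqrt t)] lies above its tangents, because
    [cosh_sqrt_slope] is monotone: in the variable [z = sqrt t] the difference
    has derivative [2 z (slope z - slope x)], so its minimum is at [z = x]. *)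
Lemma cosh_sqrt_tangent (x y : R) :
  0 <= x -> 0 <= y ->
  cosh x + cosh_sqrt_slope x * (y ^ 2 - x ^ 2) <= cosh y.
Proof.
  intros Hx Hy. set (k := cosh_sqrt_slope x).
  assert (D : forall z, is_derive (fun z => cosh z - k * z ^ 2) z
                          (2 * z * (cosh_sqrt_slope z - k))).
  { intros z. auto_derive; [trivial|]. rewrite (sinh_slope z). ring. }
  enough (cosh x - k * x ^ 2 <= cosh y - k * y ^ 2) by lra.
  destruct (Rle_lt_dec x y) as [H | H].
  - apply (nondecreasing_of_derive (fun z => cosh z - k * z ^ 2) _ x y H
             (fun z _ => D z)).
    intros z Hz. pose proof (cosh_sqrt_slope_le x z Hx (proj1 Hz)) as Hs.
    fold k in Hs. nra.
  - enough (- (cosh y - k * y ^ 2) <= - (cosh x - k * x ^ 2)) by lra.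
    apply (nondecreasing_of_derive (fun z => - (cosh z - k * z ^ 2))
             (fun z => - (2 * z * (cosh_sqrt_slope z - k))) y x).
    + lra.
    + intros z _. apply (is_derive_opp (fun z => cosh z - k * z ^ 2)), D.
    + intros z Hz.
      assert (cosh_sqrt_slope z <= k)
        by (apply cosh_sqrt_slope_le; lra).
      nra.
Qed.

(** * The length of a path *)

Lemma cont_plus (f g : R -> R) t :
  continuous f t -> continuous g t -> continuous (fun u => f u + g u) t.
Proof. exact (continuous_plus f g t). Qed.

Lemma cont_minus (f g : R -> R) t :
  continuous f t -> continuous g t -> continuous (fun u => f u - g u) t.
Proof. exact (continuous_minus f g t). Qed.

Lemma cont_mult (f g : R -> R) t :
  continuous f t -> continuous g t -> continuous (fun u => f u * g u) t.
Proof. exact (continuous_mult f g t). Qed.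

Lemma cont_pow2 (f : R -> R) t :
  continuous f t -> continuous (fun u => f u ^ 2) t.
Proof.
  intros H. apply (continuous_ext (fun u => f u * f u)); [intros u; simpl; ring|].
  now apply cont_mult.
Qed.

Lemma cont_div (f g : R -> R) t :
  continuous f t -> continuous g t -> g t <> 0 ->
  continuous (fun u => f u / g u) t.
Proof.
  intros Hf Hg N. apply cont_mult; [assumption|].
  apply continuous_comp; [assumption|]. now apply continuous_Rinv.
Qed.

Lemma cont_sqrt (f : R -> R) t :
  continuous f t -> continuous (fun u => sqrt (f u)) t.
Proof. intros H. apply (continuous_comp f sqrt); [assumption | apply continuous_sqrt]. Qed.

Lemma C1_continuous (f : R -> R) t : is_C1 f -> continuous f t.
Proof. intros H. apply (ex_derive_continuous f), H. Qed.

(** The way lengths of arbitrary paths are bounded below: a function whose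
    derivative along the path is at most the speed cannot grow by more than the
    length. *)
Lemma calibration_le_length (p q : H2) (x y phi dphi : R -> R) :
  C1_path p q x y ->
  (forall t, 0 <= t <= 1 -> is_derive phi t (dphi t)) ->
  (forall t, 0 <= t <= 1 -> continuous dphi t) ->
  (forall t, 0 <= t <= 1 ->
     dphi t <= sqrt (Derive x t ^ 2 + Derive y t ^ 2) / y t) ->
  phi 1 - phi 0 <= path_length x y.
Proof.
  intros [Cx [Cy [Hy _]]] Hd Hc Hle.
  assert (I : is_RInt dphi 0 1 (phi 1 - phi 0)).
  { apply (is_RInt_derive phi dphi);
      rewrite Rmin_left, Rmax_right by lra; assumption. }
  rewrite <- (is_RInt_unique _ _ _ _ I). apply RInt_le.
  - lra.
  - eexists; exact I.
  - apply (ex_RInt_continuous (V := R_CompleteNormedModule)).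
    rewrite Rmin_left, Rmax_right by lra. intros t Ht.
    specialize (Hy t Ht).
    apply cont_div; [| now apply C1_continuous | lra].
    apply cont_sqrt, cont_plus; apply cont_pow2; [apply Cx | apply Cy].
  - intros t Ht; apply Hle; lra.
Qed.

Lemma le_sqrt_mult (a s r : R) :
  0 <= r -> a ^ 2 <= s * r ^ 2 -> 0 <= s -> a <= sqrt s * r.
Proof.
  intros Hr H Hs. pose proof (sqrt_pos s). pose proof (sqrt_sqrt s Hs).
  destruct (Rle_lt_dec a 0); [nra|].
  apply Rsqr_incr_0_var; [unfold Rsqr; nra | nra].
Qed.

(** Up to sign and a constant, the Busemann function of the ideal point [e] of the real line. *)
Definition busemann (e x y : R) : R := ln y - ln ((x - e) ^ 2 + y ^ 2).

(** The hyperbolic gradient of a Busemann function has norm exactly 1.  The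
    Cauchy-Schwarz inequality used here has as its defect the square of the
    component of the velocity orthogonal to that gradient. *)
Lemma busemann_le_length (e : R) (p q : H2) (x y : R -> R) :
  C1_path p q x y ->
  busemann e (hx q) (hy q) - busemann e (hx p) (hy p) <= path_length x y.
Proof.
  intros HP. pose proof HP as [Cx [Cy [Hy [<- [<- [<- <-]]]]]].
  apply (calibration_le_length p q x y (fun t => busemann e (x t) (y t))
    (fun t => Derive y t / y t -
       2 * ((x t - e) * Derive x t + y t * Derive y t)
       / ((x t - e) ^ 2 + y t ^ 2))); [exact HP | | |];
    intros t Ht; specialize (Hy t Ht);
    assert (Hr : 0 < (x t - e) ^ 2 + y t ^ 2)
      by (pose proof (pow2_ge_0 (x t - e)); pose proof (pow_lt _ 2 Hy); lra).
  - unfold busemann. auto_derive.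
    + repeat split; try assumption; first [apply Cx | apply Cy].
    + change (Derive (fun u => x u) t) with (Derive x t).
      change (Derive (fun u => y u) t) with (Derive y t).
      field. split; [| lra].
      replace (_ + _) with ((x t - e) ^ 2 + y t ^ 2) by ring. lra.
  - assert (continuous x t) by now apply C1_continuous.
    assert (continuous y t) by now apply C1_continuous.
    assert (continuous (Derive x) t) by apply Cx.
    assert (continuous (Derive y) t) by apply Cy.
    repeat first
      [ apply cont_minus | apply cont_div | apply cont_plus | apply cont_pow2
      | apply cont_mult | assumption | apply continuous_const | lra ].
  - set (r := _ + _) in *. set (u := Derive x t). set (v := Derive y t).
    set (X := x t - e) in *.
    apply (Rmult_le_reg_r (y t * r)); [now apply Rmult_lt_0_compat|].
    replace ((v / y t - 2 * (X * u + y t * v) / r) * (y t * r))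
      with (v * r - 2 * y t * (X * u + y t * v)) by (field; lra).
    replace (sqrt (u ^ 2 + v ^ 2) / y t * (y t * r))
      with (sqrt (u ^ 2 + v ^ 2) * r) by (field; lra).
    apply le_sqrt_mult; [lra | | nra].
    enough (0 <= (u ^ 2 + v ^ 2) * r ^ 2
                 - (v * r - 2 * y t * (X * u + y t * v)) ^ 2) by lra.
    replace (_ - _) with ((u * (X ^ 2 - y t ^ 2) + 2 * X * y t * v) ^ 2)
      by (unfold r; ring).
    apply pow2_ge_0.
Qed.

(** The case of the ideal point at infinity. *)
Lemma log_height_le_length (p q : H2) (x y : R -> R) :
  C1_path p q x y -> ln (hy q) - ln (hy p) <= path_length x y.
Proof.
  intros HP. pose proof HP as [Cx [Cy [Hy [_ [<- [_ <-]]]]]].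
  apply (calibration_le_length p q x y (fun t => ln (y t))
    (fun t => Derive y t / y t)); [exact HP | | |];
    intros t Ht; specialize (Hy t Ht).
  - auto_derive.
    + repeat split; [apply Cy | assumption].
    + change (Derive (fun u => y u) t) with (Derive y t). field; lra.
  - apply cont_div; [apply Cy | now apply C1_continuous | lra].
  - apply Rmult_le_compat_r; [left; now apply Rinv_0_lt_compat|].
    rewrite <- (Rmult_1_r (sqrt _)). apply le_sqrt_mult; nra.
Qed.

(** * Geodesic lines *)

Lemma hdist_eq (p q : H2) (x y : R -> R) :
  C1_path p q x y ->
  (forall x' y', C1_path p q x' y' -> path_length x y <= path_length x' y') ->
  hdist p q = path_length x y.
Proof.
  intros HP Hmin. unfold hdist.
  rewrite (is_glb_Rbar_unique _ (Finite (path_length x y))); [reflexivity|].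
  split.
  - intros l [x' [y' [HP' ->]]]. now apply Hmin.
  - intros b Hb. apply Hb. now exists x, y.
Qed.

Lemma path_length_const (x y : R -> R) (l : R) :
  (forall t, 0 <= t <= 1 ->
     sqrt (Derive x t ^ 2 + Derive y t ^ 2) / y t = l) ->
  path_length x y = l.
Proof.
  intros H. unfold path_length.
  rewrite (RInt_ext _ (fun _ => l)).
  - rewrite RInt_const. unfold scal; simpl; unfold mult; simpl. ring.
  - rewrite Rmin_left, Rmax_right by lra. intros t Ht. apply H; lra.
Qed.

Lemma is_C1_intro (f df : R -> R) :
  (forall t, is_derive f t (df t)) -> (forall t, ex_derive df t) -> is_C1 f.
Proof.
  intros Hd He t. split; [now exists (df t)|].
  apply (continuous_ext df).
  - intros u. symmetry. now apply is_derive_unique.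
  - now apply (ex_derive_continuous df).
Qed.

Lemma arc_height_pos (r s : R) : 0 < r -> 0 < r / cosh s.
Proof. intros H. apply Rdiv_lt_0_compat; [assumption | apply cosh_pos]. Qed.

(** The half-circle with centre [c] and radius [r], parametrized by arc length
    from its top. *)
Definition arc (c r : R) (Hr : 0 < r) (s : R) : H2 :=
  mkH2 (c + r * sinh s / cosh s) (r / cosh s) (arc_height_pos r s Hr).

Definition ray (x s : R) : H2 := mkH2 x (exp s) (exp_pos s).

(** The affine reparametrization of the arc has constant speed [|s' - s|].  It
    is shortest because the Busemann functions of the two end points [c - r] and
    [c + r] restrict to [- u - ln (2 r)] and [u - ln (2 r)] on the arc: one of
    them grows by [|s' - s|]. *)
Lemma hdist_arc c r Hr s s' : hdist (arc c r Hr s) (arc c r Hr s') = Rabs (s' - s).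
Proof.
  set (k := s' - s).
  set (x := fun t => c + r * sinh (s + t * k) / cosh (s + t * k)).
  set (y := fun t => r / cosh (s + t * k)).
  assert (Dx : forall t, is_derive x t (r * k / cosh (s + t * k) ^ 2)).
  { intros t. pose proof (cosh_pos (s + t * k)). unfold x.
    auto_derive; [repeat split; lra|].
    replace (r * k) with
      (r * k * (cosh (s + t * k) ^ 2 - sinh (s + t * k) ^ 2))
      by (rewrite cosh2_sinh2; ring).
    field; lra. }
  assert (Dy : forall t,
    is_derive y t (- r * k * sinh (s + t * k) / cosh (s + t * k) ^ 2)).
  { intros t. pose proof (cosh_pos (s + t * k)). unfold y.
    auto_derive; [repeat split; lra|]. field; lra. }
  assert (E : path_length x y = Rabs k).
  { apply path_length_const. intros t _.
    rewrite (is_derive_unique _ _ _ (Dx t)), (is_derive_unique _ _ _ (Dy t)).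
    unfold y. pose proof (cosh_pos (s + t * k)) as P.
    pose proof (cosh2_sinh2 (s + t * k)) as E.
    set (C := cosh _) in *. set (S := sinh _) in *.
    replace (_ + _) with (Rsqr (r * k / C)).
    - rewrite sqrt_Rsqr_abs. unfold Rdiv.
      rewrite !Rabs_mult, (Rabs_pos_eq r), (Rabs_pos_eq (/ C)).
      + field; lra.
      + left; now apply Rinv_0_lt_compat.
      + lra.
    - unfold Rsqr. replace (r * k / C * (r * k / C))
        with ((r * k) ^ 2 * (1 + S ^ 2) / C ^ 4)
        by (rewrite <- E; field; lra).
      field; lra. }
  rewrite <- E. apply hdist_eq.
  - split; [| split; [| split]].
    + apply (is_C1_intro _ _ Dx). intros t.
      pose proof (cosh_pos (s + t * k)). auto_derive. nra.
    + apply (is_C1_intro _ _ Dy). intros t.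
      pose proof (cosh_pos (s + t * k)). auto_derive. nra.
    + intros t _. now apply arc_height_pos.
    + unfold x, y, k; cbn [arc hx hy].
      replace (s + 0 * (s' - s)) with s by ring.
      replace (s + 1 * (s' - s)) with s' by ring. auto.
  - intros x' y' HP. rewrite E.
    (* The Busemann functions of the two end points, along the arc. *)
    assert (B : forall u e, e = 1 \/ e = -1 ->
       busemann (c + e * r) (hx (arc c r Hr u)) (hy (arc c r Hr u))
       = e * u - ln (2 * r)).
    { intros u e He. pose proof (cosh_pos u). pose proof (exp_pos (e * u)).
      assert (0 < r / cosh u) by now apply arc_height_pos.
      assert (R : (hx (arc c r Hr u) - (c + e * r)) ^ 2 + hy (arc c r Hr u) ^ 2
                  = r / cosh u * (2 * r / exp (e * u))).
      { assert (X : exp (e * u) * (cosh u - e * sinh u) = 1).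
        { unfold cosh, sinh. destruct He as [-> | ->];
          [rewrite Rmult_1_l | replace (-1 * u) with (- u) by ring];
          pose proof (exp_plus u (- u)) as X; rewrite Rplus_opp_r, exp_0 in X;
          lra. }
        replace (2 * r / exp (e * u)) with (2 * r * (cosh u - e * sinh u)).
        - cbn [arc hx hy]. pose proof (cosh2_sinh2 u) as Y.
          assert (e ^ 2 = 1) by (destruct He as [-> | ->]; ring).
          replace (_ + _) with ((r / cosh u) ^ 2 *
             (sinh u ^ 2 - 2 * e * sinh u * cosh u + e ^ 2 * cosh u ^ 2 + 1))
            by (field; lra).
          replace (sinh u ^ 2) with (cosh u ^ 2 - 1) by lra.
          rewrite H2. field; lra.
        - apply (Rmult_eq_reg_l (exp (e * u))); [| lra].
          replace (exp (e * u) * (2 * r / exp (e * u)))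
            with (2 * r * 1) by (field; lra).
          rewrite <- X. ring. }
      unfold busemann. rewrite R, ln_mult, (ln_div (2 * r)), ln_exp; try lra.
      - cbn [arc hy]. ring.
      - apply Rdiv_lt_0_compat; lra. }
    unfold Rabs. destruct (Rcase_abs k).
    + pose proof (busemann_le_length (c + -1 * r) _ _ _ _ HP) as L.
      rewrite !B in L by auto. unfold k; lra.
    + pose proof (busemann_le_length (c + 1 * r) _ _ _ _ HP) as L.
      rewrite !B in L by auto. unfold k; lra.
Qed.

(** As for [hdist_arc], the two ideal end points being [x] and infinity. *)
Lemma hdist_ray x s s' : hdist (ray x s) (ray x s') = Rabs (s' - s).
Proof.
  set (k := s' - s).
  set (y := fun t => exp (s + t * k)).
  assert (Dx : forall t, is_derive (fun _ : R => x) t 0)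
    by (intros t; auto_derive; [trivial | ring]).
  assert (Dy : forall t, is_derive y t (k * exp (s + t * k)))
    by (intros t; unfold y; auto_derive; [trivial | ring]).
  assert (E : path_length (fun _ => x) y = Rabs k).
  { apply path_length_const. intros t _.
    rewrite (is_derive_unique _ _ _ (Dx t)), (is_derive_unique _ _ _ (Dy t)).
    unfold y. pose proof (exp_pos (s + t * k)) as P.
    replace (_ + _) with (Rsqr (k * exp (s + t * k))) by (unfold Rsqr; ring).
    rewrite sqrt_Rsqr_abs, Rabs_mult, (Rabs_pos_eq (exp _)) by lra.
    field; lra. }
  rewrite <- E. apply hdist_eq.
  - split; [| split; [| split]].
    + apply (is_C1_intro _ _ Dx). intros t. auto_derive; trivial.
    + apply (is_C1_intro _ _ Dy). intros t. auto_derive; trivial.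
    + intros t _. apply exp_pos.
    + unfold y, k; cbn [ray hx hy].
      replace (s + 0 * (s' - s)) with s by ring.
      replace (s + 1 * (s' - s)) with s' by ring. auto.
  - intros x' y' HP. rewrite E.
    unfold Rabs. destruct (Rcase_abs k).
    + pose proof (busemann_le_length x _ _ _ _ HP) as L.
      unfold busemann in L; cbn [ray hx hy] in L.
      assert (Q : forall u, (x - x) ^ 2 + exp u ^ 2 = exp u * exp u)
        by (intros; ring).
      rewrite !Q, !ln_mult, !ln_exp in L by apply exp_pos. unfold k; lra.
    + pose proof (log_height_le_length _ _ _ _ HP) as L.
      cbn [ray hx hy] in L. rewrite !ln_exp in L. unfold k; lra.
Qed.

(** The hyperbolic cosine of the distance in coordinates, equivalently
    minus the Lorentzian product of the corresponding points of the hyperboloid. *)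
Definition cosh_dist (p q : H2) : R :=
  ((hx p - hx q) ^ 2 + hy p ^ 2 + hy q ^ 2) / (2 * hy p * hy q).

Lemma H2_ext (p q : H2) : hx p = hx q -> hy p = hy q -> p = q.
Proof.
  destruct p as [x y P], q as [x' y' P']; cbn. intros <- <-.
  f_equal. apply proof_irrelevance.
Qed.

(** On the half-circle [r] and [hx p - c] are [hy p] times the hyperbolic cosine
    and sine of the parameter. *)
Lemma arc_param (c r : R) (Hr : 0 < r) (p : H2) :
  (hx p - c) ^ 2 + hy p ^ 2 = r ^ 2 ->
  arc c r Hr (arcsinh ((hx p - c) / hy p)) = p.
Proof.
  intros E. pose proof (hy_pos p) as P.
  set (s := arcsinh _).
  assert (S : sinh s = (hx p - c) / hy p) by apply sinh_arcsinh.
  assert (C : cosh s = r / hy p).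
  { apply Rsqr_inj.
    - left; apply cosh_pos.
    - left; now apply Rdiv_lt_0_compat.
    - rewrite !Rsqr_pow2, cosh2_sinh2, S. unfold Rdiv.
      rewrite !Rpow_mult_distr, <- E. field; lra. }
  apply H2_ext; cbn [arc hx hy]; rewrite ?S, C; field; lra.
Qed.

(** Besides being isometric, the parametrization is such that [cosh_dist b] is a
    combination of [cosh] and [sinh] along it: this linearity stands for the
    whole of hyperbolic trigonometry in what follows. *)
Lemma line_through (p q : H2) :
  exists (g : R -> H2) (s0 s1 : R),
    g s0 = p /\ g s1 = q /\
    (forall s s', hdist (g s) (g s') = Rabs (s' - s)) /\
    (forall s s', cosh_dist (g s) (g s') = cosh (s' - s)) /\
    (forall b, exists k1 k2, forall s,
       cosh_dist b (g s) = k1 * cosh s + k2 * sinh s).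
Proof.
  pose proof (hy_pos p) as Pp. pose proof (hy_pos q) as Pq.
  destruct (Req_EM_T (hx p) (hx q)) as [E | Hne].
  - exists (ray (hx p)), (ln (hy p)), (ln (hy q)).
    split; [apply H2_ext; cbn [ray hx hy]; rewrite ?exp_ln; trivial|].
    split; [apply H2_ext; cbn [ray hx hy]; rewrite ?exp_ln; trivial|].
    split; [apply hdist_ray|]. split.
    + intros s s'. unfold cosh_dist, cosh; cbn [ray hx hy].
      rewrite Ropp_minus_distr. unfold Rminus. rewrite !exp_plus, !exp_Ropp.
      field. split; apply Rgt_not_eq, exp_pos.
    + intros b. pose proof (hy_pos b).
      set (N := (hx b - hx p) ^ 2 + hy b ^ 2).
      exists ((N + 1) / (2 * hy b)), ((1 - N) / (2 * hy b)). intros s.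
      unfold cosh_dist, cosh, sinh; cbn [ray hx hy]. fold N.
      rewrite !exp_Ropp. field. split; [apply Rgt_not_eq, exp_pos | lra].
  - set (c := ((hx p ^ 2 + hy p ^ 2) - (hx q ^ 2 + hy q ^ 2))
              / (2 * (hx p - hx q))).
    set (r := sqrt ((hx p - c) ^ 2 + hy p ^ 2)).
    assert (Pos : 0 < (hx p - c) ^ 2 + hy p ^ 2)
      by (apply Rplus_le_lt_0_compat; [apply pow2_ge_0 | now apply pow_lt]).
    assert (Hr : 0 < r) by now apply sqrt_lt_R0.
    assert (Ep : (hx p - c) ^ 2 + hy p ^ 2 = r ^ 2)
      by (symmetry; apply pow2_sqrt; left; exact Pos).
    assert (Eq : (hx q - c) ^ 2 + hy q ^ 2 = r ^ 2)
      by (rewrite <- Ep; unfold c; field; lra).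
    exists (arc c r Hr), (arcsinh ((hx p - c) / hy p)),
      (arcsinh ((hx q - c) / hy q)).
    split; [now apply arc_param|]. split; [now apply arc_param|].
    split; [apply hdist_arc|]. split.
    + intros s s'. pose proof (cosh_pos s). pose proof (cosh_pos s').
      pose proof (cosh2_sinh2 s). pose proof (cosh2_sinh2 s').
      rewrite cosh_minus. unfold cosh_dist; cbn [arc hx hy].
      apply (Rmult_eq_reg_r (2 * cosh s * cosh s'));
        [| assert (0 < cosh s * cosh s') by (now apply Rmult_lt_0_compat); lra].
      transitivity (cosh s' ^ 2 * (1 + sinh s ^ 2)
        + cosh s ^ 2 * (1 + sinh s' ^ 2)
        - 2 * cosh s * cosh s' * sinh s * sinh s').
      * field. repeat split; lra.
      * rewrite <- !cosh2_sinh2. ring.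
    + intros b. pose proof (hy_pos b).
      set (N := (hx b - c) ^ 2 + hy b ^ 2 + r ^ 2).
      exists (N / (2 * hy b * r)), (- (hx b - c) / hy b). intros s.
      pose proof (cosh_pos s).
      transitivity ((((hx b - c) ^ 2 + hy b ^ 2) * cosh s ^ 2
        - 2 * (hx b - c) * r * sinh s * cosh s + r ^ 2 * (1 + sinh s ^ 2))
        / (2 * hy b * r * cosh s)).
      * unfold cosh_dist; cbn [arc hx hy]. field. repeat split; lra.
      * rewrite <- cosh2_sinh2. unfold N. field. repeat split; lra.
Qed.

Lemma cosh_hdist (p q : H2) : cosh (hdist p q) = cosh_dist p q.
Proof.
  destruct (line_through p q) as [g [s [s' [<- [<- [D [C _]]]]]]].
  now rewrite D, C, cosh_Rabs.
Qed.

Lemma hdist_nonneg (p q : H2) : 0 <= hdist p q.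
Proof.
  destruct (line_through p q) as [g [s [s' [<- [<- [D _]]]]]].
  rewrite D. apply Rabs_pos.
Qed.

Lemma hdist_unique (p q : H2) (l : R) :
  0 <= l -> cosh l = cosh_dist p q -> hdist p q = l.
Proof.
  intros Hl E. rewrite <- cosh_hdist in E. pose proof (hdist_nonneg p q).
  apply Rle_antisym; apply cosh_le_inv; lra.
Qed.

Lemma hdist_sym (p q : H2) : hdist p q = hdist q p.
Proof.
  apply hdist_unique; [apply hdist_nonneg|]. rewrite cosh_hdist.
  unfold cosh_dist. pose proof (hy_pos p); pose proof (hy_pos q).
  field; lra.
Qed.

(** The Gram determinant of three points of the hyperboloid is, up to sign, the
    square of the determinant of their coordinates. *)
Lemma gram_nonneg (p q b : H2) :
  0 <= 1 + 2 * cosh_dist p q * cosh_dist p b * cosh_dist b q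
       - cosh_dist p q ^ 2 - cosh_dist p b ^ 2 - cosh_dist b q ^ 2.
Proof.
  pose proof (hy_pos p); pose proof (hy_pos q); pose proof (hy_pos b).
  set (n := fun z => hx z ^ 2 + hy z ^ 2).
  set (det := (hx q - hx p) * (n b - n p) - (hx b - hx p) * (n q - n p)).
  replace (_ - _) with ((det / (2 * hy p * hy q * hy b)) ^ 2).
  - apply pow2_ge_0.
  - unfold det, n, cosh_dist. field. repeat split; lra.
Qed.

(** Nonnegativity of the Gram determinant says that
    [(cosh pq - cosh pb cosh bq)^2 <= (sinh pb sinh bq)^2], and the right-hand
    product is what the addition formula for [cosh (pb + bq)] contributes. *)
Lemma hdist_triangle (p b q : H2) : hdist p q <= hdist p b + hdist b q.
Proof.
  pose proof (gram_nonneg p q b) as G. rewrite <- !cosh_hdist in G.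
  pose proof (hdist_nonneg p b) as Hb; pose proof (hdist_nonneg b q) as Hq.
  apply cosh_le_inv; [lra|]. rewrite cosh_plus.
  pose proof (cosh2_sinh2 (hdist p b)) as Eb.
  pose proof (cosh2_sinh2 (hdist b q)) as Eq.
  apply sinh_nonneg in Hb, Hq.
  set (A := cosh (hdist p q)) in *.
  set (Cb := cosh (hdist p b)) in *. set (Sb := sinh (hdist p b)) in *.
  set (Cq := cosh (hdist b q)) in *. set (Sq := sinh (hdist b q)) in *.
  enough (A - Cb * Cq <= Sb * Sq) by lra.
  destruct (Rle_lt_dec (A - Cb * Cq) 0); [nra|].
  apply Rsqr_incr_0_var; [| nra]. unfold Rsqr.
  replace (Sb * Sq * (Sb * Sq)) with ((Cb ^ 2 - 1) * (Cq ^ 2 - 1)); [nra|].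
  rewrite Eb, Eq. ring.
Qed.

(** * Comparison with the Euclidean plane *)

(** The hypothesis says that [cosh (h + m) + cosh (h - m)] equals
    [cosh beta + cosh gamma], the conclusion that the squares of the first two
    arguments do not have a larger sum.  With [beta >= gamma], the tangents of
    [t |-> cosh (sqrt t)] at [beta ^ 2] and [gamma ^ 2] bound the increase from
    [beta] to [h + m] and the decrease from [gamma] to [|h - m|]; as the slope at
    [beta] is the larger one, the increase of the square is the smaller one. *)
Lemma cosh_median (beta gamma h m : R) :
  0 <= beta <= h + m -> 0 <= gamma <= h + m ->
  cosh beta + cosh gamma = 2 * cosh h * cosh m ->
  2 * m ^ 2 + 2 * h ^ 2 <= beta ^ 2 + gamma ^ 2.
Proof.
  (* By symmetry, [gamma <= beta]. *)
  assert (W : forall beta gamma : R, 0 <= gamma <= beta -> beta <= h + m ->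
    cosh beta + cosh gamma = 2 * cosh h * cosh m ->
    2 * m ^ 2 + 2 * h ^ 2 <= beta ^ 2 + gamma ^ 2).
  { clear. intros b c Hc Hb E.
    pose proof (cosh_sqrt_tangent b (h + m)) as T1.
    pose proof (cosh_sqrt_tangent c (Rabs (h - m))) as T2.
    rewrite cosh_Rabs, pow2_abs in T2.
    pose proof (cosh_sqrt_slope_le c b) as L.
    pose proof (cosh_sqrt_slope_pos c) as P.
    rewrite cosh_plus in T1. rewrite cosh_minus in T2.
    specialize (T1 ltac:(lra) ltac:(lra)).
    specialize (T2 ltac:(lra) (Rabs_pos _)).
    specialize (L ltac:(lra) ltac:(lra)). specialize (P ltac:(lra)).
    set (kb := cosh_sqrt_slope b) in *. set (kc := cosh_sqrt_slope c) in *.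
    assert (0 <= (h + m) ^ 2 - b ^ 2) by nra.
    assert (kc * ((h + m) ^ 2 - b ^ 2) <= kb * ((h + m) ^ 2 - b ^ 2))
      by now apply Rmult_le_compat_r.
    enough ((h + m) ^ 2 - b ^ 2 + ((h - m) ^ 2 - c ^ 2) <= 0) by nra.
    apply (Rmult_le_reg_l kc); [assumption|]. lra. }
  intros Hb Hc E. destruct (Rle_lt_dec gamma beta).
  - apply W; lra.
  - pose proof (W gamma beta). lra.
Qed.

(** If [M] is the supremum, each [t] is the midpoint of
    an end point of the interval and another point of it, so [f t <= M / 2]. *)
Lemma midconvex_nonpos (f : R -> R) (K : R) :
  (forall t, 0 <= t <= 1 -> f t <= K) ->
  f 0 <= 0 -> f 1 <= 0 ->
  (forall s t, 0 <= s <= 1 -> 0 <= t <= 1 ->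
     f ((s + t) / 2) <= (f s + f t) / 2) ->
  forall t, 0 <= t <= 1 -> f t <= 0.
Proof.
  intros HK H0 H1 Hmid.
  destruct (completeness (fun r => exists t, 0 <= t <= 1 /\ r = f t))
    as [M [Mub Mleast]].
  - exists K. intros r [t [Ht ->]]. auto.
  - exists (f 0), 0. split; [lra | trivial].
  - assert (Hle : forall t, 0 <= t <= 1 -> f t <= M)
      by (intros t Ht; apply Mub; now exists t).
    assert (Half : M <= M / 2).
    { apply Mleast. intros r [t [Ht ->]].
      destruct (Rle_lt_dec t (1 / 2)).
      - pose proof (Hmid 0 (2 * t) ltac:(lra) ltac:(lra)) as L.
        replace ((0 + 2 * t) / 2) with t in L by lra.
        pose proof (Hle (2 * t) ltac:(lra)). lra.
      - pose proof (Hmid 1 (2 * t - 1) ltac:(lra) ltac:(lra)) as L.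
        replace ((1 + (2 * t - 1)) / 2) with t in L by lra.
        pose proof (Hle (2 * t - 1) ltac:(lra)). lra. }
    intros t Ht. pose proof (Hle t Ht). lra.
Qed.

(** The CAT(0) condition in the form of Stewart's theorem: some point [m] divides
    [p q] in the ratio [t : 1 - t] and is at most as far from each [b] as in the
    Euclidean triangle with the same sides. *)
Definition euclidean_comparison {X : Type} (dist : X -> X -> R) : Prop :=
  forall p q t, 0 <= t <= 1 ->
    exists m, forall b,
      dist b m ^ 2 <=
      (1 - t) * dist b p ^ 2 + t * dist b q ^ 2 - t * (1 - t) * dist p q ^ 2.

(** The defect from Stewart's formula vanishes at both ends of the segment and is
    midpoint convex by [cosh_median], hence nonpositive in between. *)
Lemma hdist_comparison : euclidean_comparison hdist.
Proof.
  intros p q t Ht.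
  destruct (line_through p q) as [g [s0 [s1 [Ep [Eq [D [_ C]]]]]]].
  set (k := s1 - s0). set (g' := fun u => g (s0 + u * k)).
  assert (D' : forall u v, hdist (g' u) (g' v) = Rabs ((v - u) * k))
    by (intros; unfold g'; rewrite D; f_equal; ring).
  assert (E0 : g' 0 = p) by (unfold g'; rewrite <- Ep; f_equal; ring).
  assert (E1 : g' 1 = q) by (unfold g', k; rewrite <- Eq; f_equal; ring).
  exists (g' t). intros b.
  set (f := fun u => hdist b (g' u) ^ 2).
  assert (Mid : forall u v,
    f ((u + v) / 2) <= (f u + f v) / 2 - (v - u) ^ 2 * k ^ 2 / 4).
  { intros u v. unfold f.
    set (h := Rabs ((v - u) * k / 2)). set (m := g' ((u + v) / 2)).
    assert (Hh : h ^ 2 = (v - u) ^ 2 * k ^ 2 / 4)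
      by (unfold h; rewrite pow2_abs; field).
    assert (Tu : hdist b (g' u) <= h + hdist b m).
    { rewrite Rplus_comm. replace h with (hdist m (g' u));
        [apply hdist_triangle|].
      unfold m, h. rewrite D', <- Rabs_Ropp. f_equal. field. }
    assert (Tv : hdist b (g' v) <= h + hdist b m).
    { rewrite Rplus_comm. replace h with (hdist m (g' v));
        [apply hdist_triangle|].
      unfold m, h. rewrite D'. f_equal. field. }
    pose proof (hdist_nonneg b (g' u)). pose proof (hdist_nonneg b (g' v)).
    enough (2 * hdist b m ^ 2 + 2 * h ^ 2
            <= hdist b (g' u) ^ 2 + hdist b (g' v) ^ 2) by lra.
    apply cosh_median; try lra.
    unfold h. rewrite cosh_Rabs, !cosh_hdist.
    destruct (C b) as [k1 [k2 Cb]]. unfold m, g'. rewrite !Cb.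
    set (z := (v - u) * k / 2). set (w := s0 + (u + v) / 2 * k).
    replace (s0 + u * k) with (w - z) by (unfold w, z; field).
    replace (s0 + v * k) with (w + z) by (unfold w, z; field).
    unfold Rminus.
    rewrite !cosh_plus, !sinh_plus, cosh_opp.
    replace (sinh (- z)) with (- sinh z)
      by (unfold sinh; rewrite Ropp_involutive; field).
    ring. }
  (* The defect from Stewart's formula; [Mid] makes it midpoint convex. *)
  set (psi := fun u => f u - (1 - u) * f 0 - u * f 1 + u * (1 - u) * k ^ 2).
  enough (psi t <= 0) as L.
  { unfold psi, f in L. rewrite E0, E1 in L.
    replace (hdist p q ^ 2) with (k ^ 2); [lra|].
    rewrite <- Ep, <- Eq, D, pow2_abs. reflexivity. }
  assert (Fpos : forall u, 0 <= f u) by (intros; apply pow2_ge_0).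
  apply (midconvex_nonpos psi ((hdist b p + Rabs k) ^ 2 + k ^ 2)).
  - intros u Hu. unfold psi. pose proof (Fpos 0). pose proof (Fpos 1).
    pose proof (pow2_ge_0 k).
    assert (f u <= (hdist b p + Rabs k) ^ 2).
    { unfold f. pose proof (hdist_triangle b p (g' u)) as T.
      rewrite <- E0 in T at 2. rewrite D', Rabs_mult in T.
      assert (Rabs (u - 0) * Rabs k <= Rabs k).
      { rewrite Rabs_pos_eq by lra. pose proof (Rabs_pos k). nra. }
      apply pow_incr. split; [apply hdist_nonneg | lra]. }
    assert (u * (1 - u) * k ^ 2 <= 1 * k ^ 2)
      by (apply Rmult_le_compat_r; nra).
    nra.
  - unfold psi. lra.
  - unfold psi. lra.
  - intros u v _ _. unfold psi. pose proof (Mid u v). nra.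
  - exact Ht.
Qed.

(** * Four points in a CAT(0) space *)

Record CAT0 {X : Type} (dist : X -> X -> R) : Prop := {
  dist_nonneg : forall p q, 0 <= dist p q;
  dist_sym : forall p q, dist p q = dist q p;
  dist_triangle : forall p b q, dist p q <= dist p b + dist b q;
  dist_comparison : euclidean_comparison dist
}.

Lemma hdist_CAT0 : CAT0 hdist.
Proof.
  split; [exact hdist_nonneg | exact hdist_sym | exact hdist_triangle
         | exact hdist_comparison].
Qed.

(** Compare [b] and [d] with the midpoint [m] of [a c], and use
    [bd ^ 2 <= (bm + md) ^ 2 <= 2 bm ^ 2 + 2 md ^ 2]. *)
Lemma quadrilateral_inequality {X : Type} (dist : X -> X -> R) (a b c d : X) :
  CAT0 dist ->
  dist a c ^ 2 + dist b d ^ 2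
  <= dist a b ^ 2 + dist b c ^ 2 + dist c d ^ 2 + dist a d ^ 2.
Proof.
  intros [Hpos Hsym Htri Hcomp].
  destruct (Hcomp a c (1 / 2) ltac:(lra)) as [m Hm].
  pose proof (Hm b) as Hb. pose proof (Hm d) as Hd.
  rewrite (Hsym b a) in Hb. rewrite (Hsym d a), (Hsym d c) in Hd.
  pose proof (Htri b m d) as T. rewrite (Hsym m d) in T.
  pose proof (Hpos b d) as P.
  assert (dist b d ^ 2 <= (dist b m + dist d m) ^ 2)
    by (apply pow_incr; lra).
  pose proof (pow2_ge_0 (dist b m - dist d m)). nra.
Qed.

Lemma weighted_square (x y l u : R) :
  0 < l -> 0 < u -> (x + y) ^ 2 <= (l + u) * (x ^ 2 / l + y ^ 2 / u).
Proof.
  intros Hl Hu.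
  assert (E : (l + u) * (x ^ 2 / l + y ^ 2 / u) - (x + y) ^ 2
              = (u * x - l * y) ^ 2 / (l * u)) by (field; lra).
  assert (0 <= (u * x - l * y) ^ 2 / (l * u))
    by (apply Rdiv_le_0_compat;
        [apply pow2_ge_0 | now apply Rmult_lt_0_compat]).
  lra.
Qed.

(** For a cyclic Euclidean quadrilateral, where equality holds, the diagonals
    cross at the point of [a c] with [t = ab ad / (ab ad + bc cd)], which divides
    [b d] in the ratio [ab bc : cd ad].  Taking the point [m] of [a c] with this
    [t] and splitting [(bm + md) ^ 2] with these weights gives
    [bd ^ 2 + r ^ 2 ac ^ 2 <= 2 r (ab cd + ad bc)] for some [r > 0], and the
    left-hand side is at least [2 r ac bd]. *)
Lemma ptolemy_inequality {X : Type} (dist : X -> X -> R) (a b c d : X) :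
  CAT0 dist ->
  dist a c * dist b d <= dist a b * dist c d + dist a d * dist b c.
Proof.
  intros [Hpos Hsym Htri Hcomp].
  pose proof (Htri a b c) as Tabc. pose proof (Htri a d c) as Tadc.
  pose proof (Htri b a d) as Tbad. pose proof (Htri b c d) as Tbcd.
  rewrite (Hsym b a) in Tbad. rewrite (Hsym d c) in Tadc.
  pose proof (Hpos a b) as Pab. pose proof (Hpos b c) as Pbc.
  pose proof (Hpos c d) as Pcd. pose proof (Hpos a d) as Pad.
  pose proof (Hpos a c) as Pac. pose proof (Hpos b d) as Pbd.
  (* If two consecutive vertices coincide, the triangle inequality suffices. *)
  destruct Pab as [Pab | Zab]; [| nra].
  destruct Pbc as [Pbc | Zbc]; [| nra].
  destruct Pcd as [Pcd | Zcd]; [| nra].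
  destruct Pad as [Pad | Zad]; [| nra].
  assert (Pl : 0 < dist a b * dist b c) by now apply Rmult_lt_0_compat.
  assert (Pu : 0 < dist c d * dist a d) by now apply Rmult_lt_0_compat.
  assert (Pv : 0 < dist a b * dist a d) by now apply Rmult_lt_0_compat.
  assert (Pw : 0 < dist b c * dist c d) by now apply Rmult_lt_0_compat.
  set (t := dist a b * dist a d / (dist a b * dist a d + dist b c * dist c d)).
  assert (Ht : 0 <= t <= 1).
  { unfold t. split; [apply Rdiv_le_0_compat; lra|].
    apply (Rmult_le_reg_r (dist a b * dist a d + dist b c * dist c d)); [lra|].
    unfold Rdiv. rewrite Rmult_assoc, Rinv_l; lra. }
  destruct (Hcomp a c t Ht) as [m Hm].
  pose proof (Hm b) as Hb. pose proof (Hm d) as Hd. clear Hm.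
  rewrite (Hsym b a) in Hb. rewrite (Hsym d a), (Hsym d c) in Hd.
  pose proof (Htri b m d) as T. rewrite (Hsym m d) in T.
  assert (Q : dist b d ^ 2 <= (dist b m + dist d m) ^ 2)
    by (apply pow_incr; lra).
  pose proof (weighted_square (dist b m) (dist d m) _ _ Pl Pu) as W.
  set (P := dist a c) in *. set (B := dist b d) in *.
  set (x := dist b m) in *. set (y := dist d m) in *.
  set (ab := dist a b) in *. set (bc := dist b c) in *.
  set (cd := dist c d) in *. set (ad := dist a d) in *.
  set (r := (ab * bc + cd * ad) / (ab * ad + bc * cd)).
  assert (Pr : 0 < r) by (apply Rdiv_lt_0_compat; lra).
  assert (S : (ab * bc + cd * ad) * (x ^ 2 / (ab * bc) + y ^ 2 / (cd * ad))
    <= (ab * bc + cd * ad) *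
       (((1 - t) * ab ^ 2 + t * bc ^ 2 - t * (1 - t) * P ^ 2) / (ab * bc)
        + ((1 - t) * ad ^ 2 + t * cd ^ 2 - t * (1 - t) * P ^ 2) / (cd * ad))).
  { apply Rmult_le_compat_l; [lra|].
    apply Rplus_le_compat; apply Rmult_le_compat_r; try assumption;
      left; now apply Rinv_0_lt_compat. }
  assert (E : (ab * bc + cd * ad) *
       (((1 - t) * ab ^ 2 + t * bc ^ 2 - t * (1 - t) * P ^ 2) / (ab * bc)
        + ((1 - t) * ad ^ 2 + t * cd ^ 2 - t * (1 - t) * P ^ 2) / (cd * ad))
    = 2 * r * (ab * cd + ad * bc) - r ^ 2 * P ^ 2)
    by (unfold t, r; field; repeat split; lra).
  assert (G : 0 <= (r * P - B) ^ 2) by apply pow2_ge_0.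
  apply (Rmult_le_reg_l (2 * r)); lra.
Qed.

Lemma opposite_sums {X : Type} (dist : X -> X -> R) (a b c d : X) :
  CAT0 dist ->
  (dist a c + dist b d) ^ 2
  <= (dist a b + dist c d) ^ 2 + (dist a d + dist b c) ^ 2.
Proof.
  intros H.
  pose proof (quadrilateral_inequality dist a b c d H).
  pose proof (ptolemy_inequality dist a b c d H). nra.
Qed.

Lemma sqrt2_bounds : 1 < sqrt 2 /\ sqrt 2 ^ 2 = 2.
Proof.
  assert (E : sqrt 2 ^ 2 = 2) by (apply pow2_sqrt; lra).
  pose proof (sqrt_pos 2). split; [nra | exact E].
Qed.

Lemma extremal_constant : (sqrt 2 - 1) / sqrt 2 = 1 - sqrt 2 / 2.
Proof.
  destruct sqrt2_bounds as [P E].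
  apply (Rmult_eq_reg_r (sqrt 2)); [| lra].
  transitivity (sqrt 2 - sqrt 2 ^ 2 / 2); [rewrite E|]; field; lra.
Qed.

Lemma half_gap_le (L M S D : R) :
  0 <= S <= M -> M <= L -> L ^ 2 <= M ^ 2 + S ^ 2 -> L <= 2 * D ->
  (L - M) / 2 <= (1 - sqrt 2 / 2) * D.
Proof.
  intros HS HM HL HD. destruct sqrt2_bounds as [P E].
  assert (L <= sqrt 2 * M).
  { apply Rsqr_incr_0_var; [| nra]. unfold Rsqr.
    replace (sqrt 2 * M * (sqrt 2 * M)) with (sqrt 2 ^ 2 * M ^ 2) by ring.
    rewrite E. nra. }
  assert (sqrt 2 < 2) by nra. nra.
Qed.

Lemma delta_le_diam {X : Type} (dist : X -> X -> R) (a b c d : X) :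
  CAT0 dist ->
  delta dist a b c d <= (1 - sqrt 2 / 2) * diam dist a b c d.
Proof.
  intros H.
  pose proof (opposite_sums dist a b c d H) as I2.
  pose proof (opposite_sums dist a c b d H) as I1.
  pose proof (opposite_sums dist a b d c H) as I3.
  destruct H as [Hpos Hsym _ _].
  rewrite (Hsym c b) in I1. rewrite (Hsym d c) in I3.
  unfold delta, diam.
  assert (P1 := Hpos a b). assert (P2 := Hpos c d).
  assert (P3 := Hpos a c). assert (P4 := Hpos b d).
  assert (P5 := Hpos a d). assert (P6 := Hpos b c).
  set (D := Rmax _ _).
  assert (Hdiam : dist a b <= D /\ dist c d <= D /\ dist a c <= D /\
                  dist b d <= D /\ dist a d <= D /\ dist b c <= D).
  { unfold D, max3.
    repeat split; unfold Rmax; repeat destruct (Rle_dec _ _); lra. }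
  cbv zeta.
  set (s1 := dist a b + dist c d) in *.
  set (s2 := dist a c + dist b d) in *.
  set (s3 := dist a d + dist b c) in *.
  assert (H1 : 0 <= s1 <= 2 * D) by (unfold s1; lra).
  assert (H2 : 0 <= s2 <= 2 * D) by (unfold s2; lra).
  assert (H3 : 0 <= s3 <= 2 * D) by (unfold s3; lra).
  clearbody s1 s2 s3 D.
  apply (half_gap_le _ _ (min3 s1 s2 s3));
    unfold mid3, max3, min3, Rmax, Rmin;
    repeat destruct (Rle_dec _ _); try split; try lra; nra.
Qed.

(** * Small squares *)

(** The hyperbolic Pythagorean theorem for a right angle at [(0, 1)], the first
    leg lying on the unit circle and the second on the vertical axis. *)
Lemma hdist_orthogonal (s t : R) (p q : H2) :
  hx p = sinh s / cosh s -> hy p = 1 / cosh s -> hx q = 0 -> hy q = exp t ->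
  cosh (hdist p q) = cosh s * cosh t.
Proof.
  intros Hxp Hyp Hxq Hyq. rewrite cosh_hdist. unfold cosh_dist.
  rewrite Hxp, Hyp, Hxq, Hyq.
  pose proof (cosh_pos s). pose proof (exp_pos t).
  transitivity ((exp t ^ 2 * cosh s ^ 2 + (1 + sinh s ^ 2))
                / (2 * exp t * cosh s)); [field; lra|].
  rewrite <- cosh2_sinh2.
  replace (cosh t) with ((exp t + / exp t) / 2)
    by (unfold cosh; now rewrite exp_Ropp).
  field. lra.
Qed.

(** The square with centre [(0, 1)] and half-diagonal [rho]. *)
Lemma square_ratio (rho s : R) :
  0 < rho -> 0 <= s -> cosh s = cosh rho ^ 2 ->
  exists a b c d : H2,
    0 < diam hdist a b c d /\
    1 - s / (2 * rho) = delta hdist a b c d / diam hdist a b c d.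
Proof.
  intros Hr Hs Es.
  set (a := arc 0 1 Rlt_0_1 rho). set (c := arc 0 1 Rlt_0_1 (- rho)).
  set (b := ray 0 rho). set (d := ray 0 (- rho)).
  assert (Dac : hdist a c = 2 * rho)
    by (unfold a, c; rewrite hdist_arc, <- Rabs_Ropp, Rabs_pos_eq; lra).
  assert (Dbd : hdist b d = 2 * rho)
    by (unfold b, d; rewrite hdist_ray, <- Rabs_Ropp, Rabs_pos_eq; lra).
  assert (Side : forall e f, (e = rho \/ e = - rho) ->
    (f = rho \/ f = - rho) -> hdist (arc 0 1 Rlt_0_1 e) (ray 0 f) = s).
  { intros e f He Hf. apply hdist_unique; [assumption|].
    rewrite <- cosh_hdist, (hdist_orthogonal e f); cbn [arc ray hx hy];
      try reflexivity.
    - destruct He as [-> | ->], Hf as [-> | ->]; rewrite ?cosh_opp, Es; ring.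
    - pose proof (cosh_pos e). field; lra. }
  assert (Dab : hdist a b = s) by (apply Side; auto).
  assert (Dad : hdist a d = s) by (apply Side; auto).
  assert (Dbc : hdist b c = s) by (rewrite hdist_sym; apply Side; auto).
  assert (Dcd : hdist c d = s) by (apply Side; auto).
  assert (Hle : s <= 2 * rho).
  { apply cosh_le_inv; [lra|]. rewrite Es.
    replace (2 * rho) with (rho + rho) by ring. rewrite cosh_plus.
    pose proof (pow2_ge_0 (sinh rho)). lra. }
  exists a, b, c, d.
  replace (diam hdist a b c d) with (2 * rho).
  - replace (delta hdist a b c d) with (2 * rho - s).
    + split; [lra | field; lra].
    + unfold delta, mid3, max3, min3, Rmax, Rmin.
      rewrite Dab, Dcd, Dac, Dbd, Dad, Dbc.
      repeat destruct (Rle_dec _ _); lra.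
  - unfold diam, max3, Rmax. rewrite Dab, Dcd, Dac, Dbd, Dad, Dbc.
    repeat destruct (Rle_dec _ _); lra.
Qed.

Lemma sinh_le_mult_cosh (x : R) : 0 <= x -> sinh x <= x * cosh x.
Proof.
  intros Hx.
  enough (0 * cosh 0 - sinh 0 <= x * cosh x - sinh x)
    by (rewrite sinh_0 in *; lra).
  apply (nondecreasing_of_derive (fun z => z * cosh z - sinh z)
           (fun z => z * sinh z)); [assumption | |].
  - intros z _. auto_derive; [trivial | ring].
  - intros z Hz. apply Rmult_le_pos; [lra | apply sinh_nonneg; lra].
Qed.

Lemma cosh_ge_quadratic (x : R) : 0 <= x -> 1 + x ^ 2 / 2 <= cosh x.
Proof.
  intros Hx. pose proof (cosh_sqrt_tangent 0 x (Rle_refl 0) Hx) as T.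
  unfold cosh_sqrt_slope in T. rewrite cosh_0 in T.
  destruct (Req_EM_T 0 0); lra.
Qed.

(** Choosing [rho] with [cosh rho ^ 2 < k ^ 2 / 2] is enough, since then
    [cosh s - 1 = sinh rho ^ 2 <= (rho cosh rho) ^ 2 < (k rho) ^ 2 / 2
    <= cosh (k rho) - 1]. *)
Lemma small_square (k : R) :
  sqrt 2 < k ->
  exists rho s, 0 < rho /\ 0 <= s /\ cosh s = cosh rho ^ 2 /\ s < k * rho.
Proof.
  intros Hk. destruct sqrt2_bounds as [P E].
  assert (Hk2 : 2 < k ^ 2) by nra.
  set (eta := sqrt ((k ^ 2 / 2 - 1) / 2)).
  assert (Heta : 0 < eta) by (apply sqrt_lt_R0; lra).
  assert (Eeta : eta ^ 2 = (k ^ 2 / 2 - 1) / 2) by (apply pow2_sqrt; lra).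
  set (rho := arcsinh eta).
  assert (Sr : sinh rho = eta) by apply sinh_arcsinh.
  assert (Hr : 0 < rho)
    by (rewrite <- arcsinh_0; now apply arcsinh_lt).
  assert (C2 : cosh rho ^ 2 = 1 + eta ^ 2) by (rewrite <- Sr; apply cosh2_sinh2).
  (* The side of the square with half-diagonal [rho]. *)
  set (s := hdist (arc 0 1 Rlt_0_1 rho) (ray 0 rho)).
  assert (Es : cosh s = cosh rho ^ 2).
  { unfold s. rewrite (hdist_orthogonal rho rho); cbn [arc ray hx hy];
      try reflexivity; [ring|].
    pose proof (cosh_pos rho). field; lra. }
  exists rho, s. repeat split; try assumption; [apply hdist_nonneg|].
  assert (Hs : sinh rho ^ 2 < (k * rho) ^ 2 / 2).
  { pose proof (sinh_le_mult_cosh rho ltac:(lra)) as L.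
    assert (sinh rho ^ 2 <= (rho * cosh rho) ^ 2)
      by (apply pow_incr; lra).
    rewrite Rpow_mult_distr, C2, Eeta in H.
    pose proof (pow_lt rho 2 Hr). rewrite Rpow_mult_distr. nra. }
  pose proof (cosh_ge_quadratic (k * rho) ltac:(nra)) as G.
  rewrite cosh2_sinh2 in Es.
  destruct (Rlt_le_dec s (k * rho)) as [|Hle]; [assumption|].
  apply cosh_le in Hle; [lra | nra].
Qed.

Theorem mainTheorem4 :
  is_lub
    (fun r : R => exists a b c d : H2,
       0 < diam hdist a b c d /\
       r = delta hdist a b c d / diam hdist a b c d)
    ((sqrt 2 - 1) / sqrt 2).
Proof.
  rewrite extremal_constant. split.
  - intros r [a [b [c [d [HD ->]]]]].
    apply (Rmult_le_reg_r (diam hdist a b c d)); [assumption|].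
    pose proof (delta_le_diam hdist a b c d hdist_CAT0).
    unfold Rdiv at 1. rewrite Rmult_assoc, Rinv_l, Rmult_1_r by lra.
    assumption.
  - intros u Hu.
    destruct (Rle_lt_dec (1 - sqrt 2 / 2) u) as [|Hlt]; [assumption|].
    destruct (small_square (2 * (1 - u)) ltac:(lra))
      as [rho [s [Hr [Hs [Es Hlt']]]]].
    pose proof (Hu _ (square_ratio rho s Hr Hs Es)) as Hle.
    assert (s / (2 * rho) < 1 - u); [| lra].
    apply (Rmult_lt_reg_r (2 * rho)); [lra|].
    unfold Rdiv. rewrite Rmult_assoc, Rinv_l, Rmult_1_r by lra. lra.
Qed.
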